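(* Let $A,U_J,U_K$ be nonempty sets, let $n\geqslant 3$ be an integer, and let $J\colon A^{n-1}\to U_J$ and $K\colon A^{n-1}\to U_K$ be functions. Assume that $\operatorname{ran}(K)=\operatorname{ran}(K_{n-1}^a)$ for some $a\in A$, and let $F\in\mathcal{F}_{J,K}$. Let $k\in Q(K_{n-1}^a)$ and let $R=R_k\colon A^n\to U_J$ be defined by $R(x_1,\ldots,x_n)=J(x_1,k(K(x_2,\ldots,x_n)))$. Assume that $\operatorname{ran}(R)=\operatorname{ran}(\delta_R)$. Then the following assertions hold. (a) $F=\delta_F\circ r\circ R$ for every $r\in Q(\delta_R)$. (b) If $F'=f'\circ R$ satisfies $\delta_F=\delta_{F'}$ for some $f'\colon U_J\to\operatorname{ran}(F)$, then $F=F'$. (c) If $F$ is idempotent, then $F=r\circ R$ for every $r\in Q(\delta_R)$. (d) If $r\circ R$ is not idempotent for some $r\in Q(\delta_R)$, then $F$ is not idempotent. (e) For every $r\in Q(\delta_R)$, the function $r\circ R$ is range-idempotent (i.e., $r\circ\delta_R\circ r\circ R=r\circ R$). It is idempotent if and only if $\delta_R$ is one-to-one. Moreover, if $F\in\mathcal{F}^A_{J,K}$, then for every $r\in Q(\delta_R)$ we have $r\circ R\in\mathcal{F}^A_{J,K}$ if and only if $$\mathcal{F}^A_{J,K}=\{f\circ r\circ R\mid f\colon A\to A\}.$$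
   Context: For a function $h$, $\operatorname{dom}(h)$ and $\operatorname{ran}(h)$ denote its domain and range. Functions with the same domain and the same values are regarded as equal (codomains are disregarded when comparing functions or deciding class membership). $\mathcal{F}_{J,K}$ is the class of functions $F\colon A^n\to\operatorname{ran}(F)$ for which there exist $G\colon U_J\times A\to\operatorname{ran}(F)$ and $H\colon A\times U_K\to\operatorname{ran}(F)$ such that $F(x_1,\ldots,x_n)=G(J(x_1,\ldots,x_{n-1}),x_n)=H(x_1,K(x_2,\ldots,x_n))$ for all $x_1,\ldots,x_n\in A$. Also $\mathcal{F}^A_{J,K}=\{F\in\mathcal{F}_{J,K}\mid\operatorname{ran}(F)\subseteq A\}$. The section $K_{n-1}^a\colon A^{n-2}\to U_K$ is defined by $K_{n-1}^a(y)=K(y,a)$ for $y\in A^{n-2}$ (the last argument of $K$ is fixed to $a$). Since $k$ takes values in $A^{n-2}$, the expression $J(x_1,k(\cdot))$ means $J$ evaluated at the $(n-1)$-tuple obtained by putting $x_1$ before the components of $k(\cdot)$. The diagonal section of a function $F$ on $A^n$ is $\delta_F(x)=F(x,\ldots,x)$, $x\in A$. A function $F$ on $A^n$ is idempotent if $\delta_F(x)=x$ for all $x\in A$. A function $F\colon A^n\to A$ is range-idempotent if $\delta_F\circ F=F$. $Q(h)$ denotes the set of quasi-inverses of a function $h$: a function $g$ is a quasi-inverse of $h$ if $\operatorname{ran}(h)\subseteq\operatorname{dom}(g)$, $\operatorname{ran}(g)\subseteq\operatorname{dom}(h)$, $h\circ g|_{\operatorname{ran}(h)}=\mathrm{id}_{\operatorname{ran}(h)}$,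 and $\operatorname{ran}(g|_{\operatorname{ran}(h)})=\operatorname{ran}(g)$. The Axiom of Choice is assumed, so every function has a quasi-inverse. *)

(* Defs.v *)
From mathcomp Require Import all_boot.
From mathcomp Require Import boolp classical_sets.

Set Implicit Arguments.
Unset Strict Implicit.
Unset Printing Implicit Defensive.

Local Open Scope classical_set_scope.

(** The base set is [A : set T], so that an operation [F] on [A] can take values
    in the ambient type [T], inside or outside [A], and "F is idempotent" and
    "ran(F) is included in A" are meaningful for every [F]. An operation that
    has codomain [A] is seen as a [T]-valued one by composing it with [\val],
    which amounts to disregarding codomains. *)

(** Only the values of [pfn] on [pdom] are meaningful: [pfn] is an arbitrary
    total extension of the partial function. *)
Record pfun (X Y : Type) := PFun { pdom : set X; pfn :> X -> Y }.

Definition pran (X Y : Type) (g : pfun X Y) : set Y := g @` pdom g.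

(** Q(h), for [h] with domain [X]; the requirement that ran(g) be included in
    dom(h) is carried by the type of [g]. *)
Definition quasi_inverses (X Y : Type) (h : X -> Y) : set (pfun Y X) :=
  [set g | [/\ range h `<=` pdom g,
               forall y, range h y -> h (g y) = y
             & g @` range h = pran g]].

Definition tinit (X : Type) (n : nat) (x : n.+1.-tuple X) : n.-tuple X :=
  [tuple of belast (thead x) (behead x)].

Definition tlast (X : Type) (n : nat) (x : n.+1.-tuple X) : X :=
  tnth x ord_max.

Definition diag (X Y : Type) (n : nat) (F : n.-tuple X -> Y) : X -> Y :=
  fun x => F [tuple of nseq n x].

Definition is_idempotent (T : Type) (A : set T) (n : nat) (F : n.-tuple A -> T) :
  Prop := forall x : A, diag F x = \val x.

Definition range_idempotent (X : Type) (n : nat) (F : n.-tuple X -> X) : Prop :=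
  diag F \o F = F.

Definition last_section (X Y : Type) (n : nat) (K : n.+1.-tuple X -> Y) (a : X) :
  n.-tuple X -> Y := fun y => K [tuple of rcons y a].

(** In the next three definitions the arity of [F] and [R] is [m.+3]. *)

Definition classF (T : Type) (A : set T) (UJ UK : Type) (m : nat)
    (J : m.+2.-tuple A -> UJ) (K : m.+2.-tuple A -> UK) :
  set (m.+3.-tuple A -> T) :=
  [set F | exists (G : UJ * A -> range F) (H : A * UK -> range F),
     forall x : m.+3.-tuple A,
       F x = \val (G (J (tinit x), tlast x)) /\
       F x = \val (H (thead x, K [tuple of behead x]))].

Definition classFA (T : Type) (A : set T) (UJ UK : Type) (m : nat)
    (J : m.+2.-tuple A -> UJ) (K : m.+2.-tuple A -> UK) :
  set (m.+3.-tuple A -> T) :=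
  [set F | classF J K F /\ range F `<=` A].

Definition Rk (X UJ UK : Type) (m : nat) (J : m.+2.-tuple X -> UJ)
    (K : m.+2.-tuple X -> UK) (k : pfun UK (m.+1.-tuple X)) :
  m.+3.-tuple X -> UJ :=
  fun x => J [tuple of thead x :: k (K [tuple of behead x])].

(* Main.v *)
Require Import Defs.
From mathcomp Require Import all_boot.
From mathcomp Require Import boolp classical_sets.

Local Open Scope classical_set_scope.

(** Membership in the class forces [F] to factor through [R]: if [y] is
    [k (K (x_2, ..., x_n))], then [K (y, a) = K (x_2, ..., x_n)], so that
    [F x = H (x_1, K (y, a)) = F (x_1, y, a) = G (J (x_1, y), a) = G (R x, a)].
    Since [R] and its diagonal have the same range, a function that factors
    through [R] is determined by its diagonal, and a quasi-inverse of the
    diagonal of [R] recovers it. *)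

Lemma tinit_cons_rcons (X : Type) (n : nat) (x a : X) (y : n.-tuple X) :
  tinit [tuple of x :: rcons y a] = [tuple of x :: y].
Proof.
by apply: val_inj; rewrite /= theadE belast_rcons.
Qed.

Lemma tlast_cons_rcons (X : Type) (n : nat) (x a : X) (y : n.-tuple X) :
  tlast [tuple of x :: rcons y a] = a.
Proof.
by rewrite /tlast (tnth_nth a) /= nth_rcons size_tuple ltnn eqxx.
Qed.

Lemma classF_factor {T : Type} {A : set T} {UJ UK : Type} {m : nat}
    {J : m.+2.-tuple A -> UJ} {K : m.+2.-tuple A -> UK} {a : A}
    {F : m.+3.-tuple A -> T} {k : pfun UK (m.+1.-tuple A)} :
  range K = range (last_section K a) ->
  quasi_inverses (last_section K a) k ->
  classF J K F -> exists g : UJ -> T, F = g \o Rk J K k.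
Proof.
move=> ranK [_ kK _] [G [H FGH]].
(* The last argument of [G] is frozen at [a], the final entry of the tuple [w] below, on which [F]
   takes the same value as on [x]. *)
exists (fun u => \val (G (u, a))); apply/funext => x /=; rewrite /Rk.
set z := [tuple of behead x].
have Kz : last_section K a (k (K z)) = K z.
  by apply: kK; rewrite -ranK; exists z.
set w := [tuple of thead x :: rcons (k (K z)) a].
have wE : [tuple of behead w] = [tuple of rcons (k (K z)) a].
  exact: val_inj.
have -> : F x = F w by rewrite (FGH x).2 (FGH w).2 wE -[K z in LHS]Kz.
by rewrite (FGH w).1 tinit_cons_rcons tlast_cons_rcons.
Qed.

(** Such an [F'] is [F] followed by a map [phi] from [range F] to [range F'], and composing [phi]
    with [G] and [H] gives the two factorizations of [F']. *)
Lemma classF_kernel {T : Type} {A : set T} {UJ UK : Type} {m : nat}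
    {J : m.+2.-tuple A -> UJ} {K : m.+2.-tuple A -> UK}
    {F F' : m.+3.-tuple A -> T} :
  (forall x y, F x = F y -> F' x = F' y) -> classF J K F -> classF J K F'.
Proof.
move=> FF' [G [H FGH]].
have /choice[phi phiE] (s : range F) :
    exists t : range F', forall x, F x = \val s -> F' x = \val t.
  have [y _ Fy] := set_mem (valP s).
  have F'y : F' y \in range F' by apply/mem_set; exists y.
  by exists (SigSub F'y) => x; rewrite -Fy => /FF'.
exists (phi \o G), (phi \o H) => x.
by split; apply: phiE; [rewrite (FGH x).1 | rewrite (FGH x).2].
Qed.

Lemma quasi_inverse_diagK {X Y : Type} {n : nat} {R : n.-tuple X -> Y}
    {r : pfun Y X} :
  range R = range (diag R) -> quasi_inverses (diag R) r ->
  forall x, diag R (r (R x)) = R x.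
Proof. by move=> ranR [_ rK _] x; apply: rK; rewrite -ranR; exists x. Qed.

Lemma diag_inj_factor {X Y Z : Type} {n : nat} {R : n.-tuple X -> Y}
    {F F' : n.-tuple X -> Z} {g g' : Y -> Z} :
  range R = range (diag R) -> F = g \o R -> F' = g' \o R ->
  diag F = diag F' -> F = F'.
Proof.
move=> ranR -> -> gg'; apply/funext => x /=.
have [z _ <-] : range (diag R) (R x) by rewrite -ranR; exists x.
exact: (congr1 (@^~ z) gg').
Qed.

Theorem theorem15 (T : Type) (A : set T) (UJ UK : Type)
  (A0 : A !=set0) (UJ0 : inhabited UJ) (UK0 : inhabited UK)
  (m : nat)
  (J : m.+2.-tuple A -> UJ) (K : m.+2.-tuple A -> UK)
  (a : A) (ranK : range K = range (last_section K a))
  (F : m.+3.-tuple A -> T) (FJK : classF J K F)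
  (k : pfun UK (m.+1.-tuple A)) (Qk : quasi_inverses (last_section K a) k)
  (R : m.+3.-tuple A -> UJ) (defR : R = Rk J K k)
  (ranR : range R = range (diag R)) :
  (* (a) *)
  (forall r : pfun UJ A, quasi_inverses (diag R) r -> F = diag F \o r \o R) /\
  (* (b) *)
  (forall F' : m.+3.-tuple A -> T,
     (exists f' : UJ -> range F, F' = \val \o f' \o R) ->
     diag F = diag F' -> F = F') /\
  (* (c) *)
  (is_idempotent F ->
   forall r : pfun UJ A, quasi_inverses (diag R) r -> F = \val \o r \o R) /\
  (* (d) *)
  ((exists r : pfun UJ A,
      quasi_inverses (diag R) r /\ ~ is_idempotent (\val \o r \o R)) ->
   ~ is_idempotent F) /\
  (* (e) *)
  (forall r : pfun UJ A, quasi_inverses (diag R) r ->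
     [/\ range_idempotent (r \o R),
         r \o diag R \o r \o R = r \o R
       & is_idempotent (\val \o r \o R) <-> injective (diag R)]) /\
  (* moreover *)
  (classFA J K F ->
   forall r : pfun UJ A, quasi_inverses (diag R) r ->
     (classFA J K (\val \o r \o R) <->
      classFA J K = [set \val \o f \o r \o R | f in [set: A -> A]])).
Proof.
have factorF (F' : m.+3.-tuple A -> T) : classF J K F' ->
    exists g : UJ -> T, F' = g \o R.
  by rewrite defR; apply: classF_factor ranK Qk.
have diagF (F' : m.+3.-tuple A -> T) (r : pfun UJ A) : classF J K F' ->
    quasi_inverses (diag R) r -> F' = diag F' \o r \o R.
  move=> /factorF[g ->] Qr; apply/funext => x.
  (* Once [R x] is written as [diag R (r (R x))], applying [g] gives by conversion the diagonal of
     [g \o R] at [r (R x)]. *)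
  by rewrite -[LHS]/(g (R x)) -(quasi_inverse_diagK ranR Qr x).
have idemF (r : pfun UJ A) : is_idempotent F -> quasi_inverses (diag R) r ->
    F = \val \o r \o R.
  move=> idF Qr; rewrite {1}(diagF F r FJK Qr).
  by apply/funext => x; apply: idF.
split; first by move=> r; apply: diagF.
split.
  move=> F' [f' F'E]; have [g FE] := factorF _ FJK.
  exact: diag_inj_factor ranR FE F'E.
split; first by move=> idF r; apply: idemF.
split; first by move=> [r [Qr nid]] idF; apply: nid; rewrite -idemF.
split.
  move=> r Qr; have rK := quasi_inverse_diagK ranR Qr.
  (* Range-idempotence of [r \o R] unfolds to this same equation. *)
  have rRK : r \o diag R \o r \o R = r \o R.
    by apply/funext => x /=; rewrite rK.
  split=> //; split=> [idr x y Rxy | injR x].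
    (* Idempotence says that [r] is a left inverse of [diag R]. *)
    by apply: val_inj; rewrite -(idr x) -(idr y); congr (\val (r _)).
  (* Here [rK] is used at the constant tuple of value [x], where [R] takes the value [diag R x]. *)
  by congr (\val _); apply: injR; apply: rK.
move=> _ r Qr; split=> [[rRJK _] | ->]; last by exists id.
apply/seteqP; split=> F'.
  move=> [F'JK F'A].
  (* The map [f] is the diagonal of [F'], corestricted to [A]; part (a) applied to [F'] then gives
     the factorization. *)
  have F'mem x : diag F' x \in A.
    by apply/mem_set/F'A; exists [tuple of nseq m.+3 x].
  exists (fun x => SigSub (F'mem x)) => //.
  by rewrite [RHS](diagF F' r F'JK Qr).
move=> [f _ <-]; split; last first.
  by move=> _ [x _ <-]; apply/set_mem/valP.
(* Composing with [f] only merges fibers of [r \o R], so membership is inherited from [r \o R]. *)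
apply: classF_kernel rRJK => x y /= /val_inj rxy.
by rewrite rxy.
Qed.
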